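(* Let $p \geq 5$ be a prime number such that the polynomial $X^3-X-1$ has fewer than $3$ distinct roots in $\mathbb{F}_p$. A $\Phi_{3}$-sequence $(a_n)_{n\in\mathbb{Z}}$ in $\mathbb{F}_p$ is a complete Padovan sequence if and only if $a_n=b^n$ for all $n$, where $b$ is a Padovan primitive root.
   Context: For a prime $p\ge 5$ and $\kappa\in\{2,\dots,p-2\}$, a sequence $(a_n)_{n\in\mathbb{Z}}$ of elements of $\mathbb{F}_p$ is a $\Phi_\kappa$-sequence if $a_0=1$ and $a_{n+\kappa}=a_n+a_{n+1}$ in $\mathbb{F}_p$ for all $n\in\mathbb{Z}$. It is complete if it is periodic with period $p-1$ and $\{a_1,\dots,a_{p-2}\}=\{2,\dots,p-1\}$. A complete $\Phi_3$-sequence is called a complete Padovan sequence. A Padovan primitive root is a primitive root $b$ mod $p$ (viewed in $\mathbb{F}_p$) satisfying $b^3=b+1$. *)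

(* Defs.v *)
From HB Require Import structures.
From mathcomp Require Import all_boot all_order all_algebra.

Set Implicit Arguments.
Unset Strict Implicit.
Unset Printing Implicit Defensive.

Import Order.TTheory GRing.Theory Num.Theory.
Local Open Scope ring_scope.

Definition Phi_sequence (p kappa : nat) (a : int -> 'F_p) : Prop :=
  a 0 = 1 /\ forall n : int, a (n + kappa%:Z) = a n + a (n + 1).

(* The two index sets below are {1, ..., p - 2} and {2, ..., p - 1}. The set
   equality, with a 0 = 1, forces p - 1 to be the least period of a. *)
Definition complete_Phi_sequence (p kappa : nat) (a : int -> 'F_p) : Prop :=
  [/\ Phi_sequence kappa a,
      forall n : int, a (n + p.-1%:Z) = a n
    & [set a (i : nat)%:Z | i : 'I_p.-1 & (0 < i)%N]
      = [set ((k : nat)%:R : 'F_p) | k : 'I_p & (1 < k)%N]].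

Definition complete_Padovan_sequence (p : nat) (a : int -> 'F_p) : Prop :=
  complete_Phi_sequence 3 a.

Definition Padovan_primitive_root (p : nat) (b : 'F_p) : Prop :=
  p.-1.-primitive_root b /\ b ^+ 3 = b + 1.

(* Main.v *)
(* Since x^(p-1) = 1 for x in F_p^*, a sequence of period p-1 has a Fourier
   expansion a_n = sum_x c_x x^n over F_p^*, and the recurrence forces
   c_x (x^3 - x - 1) = 0. With one root in the support, a_0 = 1 gives a_n = b^n.
   With two roots r, s in the support, the third root -r-s must coincide with
   one of them, say r = -2s, and then p = 23, where -2 is a primitive root; so
   a_n = s^n (c (-2)^n + d) vanishes for some n, contradicting completeness. *)
Require Import Defs.
From HB Require Import structures.
From mathcomp Require Import all_boot all_order all_algebra.
From mathcomp Require Import cyclic finfield ring.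

Set Implicit Arguments.
Unset Strict Implicit.
Unset Printing Implicit Defensive.

Import Order.TTheory GRing.Theory Num.Theory.
Local Open Scope ring_scope.

(** * Periodic sequences indexed by the integers *)

Lemma periodic_mulz (T : Type) (N : nat) (a : int -> T) :
  (forall n : int, a (n + N%:Z) = a n) ->
  forall (k n : int), a (n + k * N%:Z) = a n.
Proof.
move=> aN; elim/int_rect=> [|k IHk|k IHk] n; first by rewrite mul0r addr0.
  by rewrite intS mulrDl mul1r addrA IHk aN.
rewrite -(aN (n + _)) -[RHS](IHk n); congr a.
by rewrite intS; ring.
Qed.

Lemma periodic_eq (T : Type) (N : nat) (a b : int -> T) : (0 < N)%N ->
  (forall n : int, a (n + N%:Z) = a n) -> (forall n : int, b (n + N%:Z) = b n) ->
  (forall n : nat, (n < N)%N -> a n%:Z = b n%:Z) -> a =1 b.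
Proof.
move=> N0 aN bN ab n; rewrite (divz_eq n N%:Z) addrC !periodic_mulz //.
have: (n %% N%:Z)%Z < N%:Z by rewrite ltz_pmod.
have: 0 <= (n %% N%:Z)%Z by rewrite modz_ge0 // eqz_nat -lt0n.
by case: (n %% N%:Z)%Z => // m _ /ab.
Qed.

Lemma sum_shift_periodic (V : zmodType) (N : nat) (f : nat -> V) :
  f N = f 0 -> \sum_(m < N) f m.+1 = \sum_(m < N) f m.
Proof.
case: N => [|N] fN; first by rewrite !big_ord0.
by rewrite big_ord_recr fN [RHS]big_ord_recl addrC.
Qed.

(** * Fourier transform over the nonzero elements of a finite field *)

Definition fourier (F : fieldType) (N : nat) (a : int -> F) (x : F) : F :=
  \sum_(m < N) a m%:Z * x ^- m.

(** Both [a] and the powers of [x] have period [N], so the sum may be reindexed cyclically, at the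
    cost of one factor [x]. *)
Lemma fourier_shift (F : fieldType) (N : nat) (a : int -> F) (x : F) :
  x != 0 -> x ^+ N = 1 -> (forall n : int, a (n + N%:Z) = a n) ->
  fourier N (fun n => a (n + 1)) x = x * fourier N a x.
Proof.
move=> x0 xN aN; rewrite /fourier.
rewrite -(@sum_shift_periodic _ _ (fun m => a m%:Z * x ^- m)); last first.
  by rewrite xN expr0 -[in LHS](add0r N%:Z) aN.
rewrite mulr_sumr; apply: eq_bigr => m _.
by rewrite exprS invfM mulrCA mulVKf // -PoszD addn1.
Qed.

Section FiniteField.
Variable F : finFieldType.
Local Notation N := #|F|.-1.

Lemma expf_card_pred (x : F) : x != 0 -> x ^+ N = 1.
Proof.
move=> x0; apply: (mulfI x0); rewrite -exprS prednK ?expf_card ?mulr1 //.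
exact: ltnW (finNzRing_gt1 F).
Qed.

Lemma card_pred_gt0 : (0 < N)%N.
Proof. by rewrite -subn1 subn_gt0 finNzRing_gt1. Qed.

Lemma has_primitive_root : exists g : F, N.-primitive_root g.
Proof.
have /hasP[g _ gP] : has N.-primitive_root (enum (predC1 (0 : F))).
  apply: has_prim_root; rewrite ?card_pred_gt0 ?enum_uniq //.
    by apply/allP => x; rewrite mem_enum unity_rootE => /expf_card_pred ->.
  by rewrite -cardE cardC1.
by exists g.
Qed.

(** Orthogonality of characters: for a generator [g], the substitution of [g * x] for [x] permutes
    the units and multiplies the sum by [g ^+ n * g ^- m]. This factor is not 1 when [n] and [m]
    differ, so the sum is then 0. *)
Lemma sum_units_expf (n m : nat) : (n < N)%N -> (m < N)%N ->
  \sum_(x : F | x != 0) x ^+ n * x ^- m = if n == m then N%:R else 0.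
Proof.
move=> nN mN; case: eqP => [->|/eqP nm].
  under eq_bigr => x x0 do rewrite divff ?expf_neq0 //.
  rewrite sumr_const; congr (_ *+ _); exact: cardC1.
have [g gP] := has_primitive_root.
have g0 : g != 0.
  apply: contra_eq_neq (prim_expr_order gP) => ->.
  by rewrite expr0n gtn_eqF ?card_pred_gt0 // eq_sym oner_eq0.
have gnm : g ^+ n * g ^- m != 1.
  rewrite -(inj_eq (mulIf (expf_neq0 m g0))) mulfVK ?expf_neq0 // mul1r.
  by rewrite (eq_prim_root_expr gP) !modn_small.
apply: (@mulIf _ (1 - g ^+ n * g ^- m)); first by rewrite subr_eq0 eq_sym.
rewrite mul0r mulrBr mulr1; apply/eqP; rewrite subr_eq0; apply/eqP.
rewrite [LHS](reindex_inj (mulfI g0)) /= mulr_suml.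
apply: eq_big => [x|x _]; first by rewrite mulf_eq0 negb_or g0.
by rewrite !exprMn invfM; ring.
Qed.

Lemma fourier_inversion (a : int -> F) (n : nat) : (n < N)%N ->
  \sum_(x : F | x != 0) fourier N a x * x ^+ n = N%:R * a n%:Z.
Proof.
move=> nN; under eq_bigr do rewrite mulr_suml.
rewrite exchange_big /= (bigD1 (Ordinal nN)) //= [X in _ + X]big1 => [|m mn].
  under eq_bigr do rewrite -mulrA [_ ^- _ * _]mulrC.
  by rewrite -mulr_sumr sum_units_expf // eqxx addr0 mulrC.
under eq_bigr do rewrite -mulrA [_ ^- _ * _]mulrC.
rewrite -mulr_sumr sum_units_expf // ifN ?mulr0 //.
by rewrite eq_sym.
Qed.

End FiniteField.

(** The transform turns a shift into multiplication by [x], so the recurrence becomes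
    [x ^+ 3 * A = (x + 1) * A], where [A] is the coefficient at [x]; a nonzero [A] cancels. *)
Lemma fourier_Padovan (F : fieldType) (N : nat) (a : int -> F) (x : F) :
  x != 0 -> x ^+ N = 1 -> (forall n : int, a (n + N%:Z) = a n) ->
  (forall n : int, a (n + 3%:Z) = a n + a (n + 1)) ->
  fourier N a x != 0 -> x ^+ 3 = x + 1.
Proof.
move=> x0 xN aN a3 ax0; apply: (mulIf ax0).
have sh (b : int -> F) : (forall n : int, b (n + N%:Z) = b n) ->
    forall n : int, b (n + N%:Z + 1) = b (n + 1).
  by move=> bN n; rewrite addrAC bN.
have e3 : fourier N (fun n => a (n + 1 + 1 + 1)) x = x ^+ 3 * fourier N a x.
  rewrite (@fourier_shift _ _ (fun n => a (n + 1 + 1))) //; last first.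
    by move=> n; rewrite !(addrAC _ N%:Z) aN.
  rewrite (@fourier_shift _ _ (fun n => a (n + 1))) ?fourier_shift //.
    by ring.
  exact: sh.
rewrite -e3 mulrDl mul1r addrC -fourier_shift // /fourier -big_split /=.
by apply: eq_bigr => m _; rewrite -mulrDl -a3 -!addrA.
Qed.

(** * Roots of X^3 - X - 1 *)

(** The polynomial has no quadratic term, so its three roots sum to 0. *)
Lemma third_Padovan_root (R : idomainType) (r s : R) :
  r ^+ 3 = r + 1 -> s ^+ 3 = s + 1 -> r != s ->
  (- r - s) ^+ 3 = - r - s + 1.
Proof.
move=> rP sP rs.
have q1 : r ^+ 2 + r * s + s ^+ 2 = 1.
  apply: (@mulfI _ (r - s)); first by rewrite subr_eq0.
  have -> : (r - s) * (r ^+ 2 + r * s + s ^+ 2) = r ^+ 3 - s ^+ 3 by ring.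
  by rewrite rP sP; ring.
apply/eqP; rewrite -subr_eq0; apply/eqP.
(* With t = -r-s, this factors the difference of the cubic at t and at r: t^2 + tr + r^2 equals r^2
   + rs + s^2. *)
have -> : (- r - s) ^+ 3 - (- r - s + 1) = (r ^+ 3 - (r + 1))
  + (- r - s - r) * (r ^+ 2 + r * s + s ^+ 2 - 1) by ring.
by rewrite q1 rP !subrr mulr0 addr0.
Qed.

(** Eliminating s^3 from the two equations gives 6s = -9. Substituting this in 216(s^3 - s - 1) = 0
    gives -621 = 0, and 621 = 3^3 * 23. *)
Lemma double_Padovan_root (p : nat) (s : 'F_p) : prime p -> (5 <= p)%N ->
  s ^+ 3 = s + 1 -> (- 2 * s) ^+ 3 = - 2 * s + 1 -> p = 23.
Proof.
move=> pp p5 sP rP.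
have s6 : 6 * s = - 9.
  apply/eqP; rewrite -subr_eq0; apply/eqP.
  have -> : 6 * s - - 9 = - ((- 2 * s) ^+ 3 - (- 2 * s + 1))
    - 8 * (s ^+ 3 - (s + 1)) by ring.
  by rewrite sP rP !subrr mulr0 oppr0 addr0.
have p621 : 621%:R = 0 :> 'F_p.
  have -> : 621%:R = (6 * s) ^+ 3 - (- 9) ^+ 3 - 36 * (6 * s - - 9)
    - 216 * (s ^+ 3 - (s + 1)) :> 'F_p by ring.
  by rewrite sP s6 !subrr !mulr0 !subr0.
move/eqP: p621; rewrite -(dvdn_pcharf (pchar_Fp pp)) (_ : 621 = 3 ^ 3 * 23)%N //.
rewrite Euclid_dvdM // Euclid_dvdX // andbT !dvdn_prime2 //.
by case/orP => /eqP // p3; move: p5; rewrite p3.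
Qed.

Lemma opp2_generates_F23 (x : 'F_23) :
  x != 0 -> exists2 n : nat, (n < 22)%N & x = (- 2) ^+ n.
Proof.
have chk : all (fun k : nat => (k%:R == 0 :> 'F_23) ||
    has (fun n => k%:R == (- 2) ^+ n :> 'F_23) (iota 0 22)) (iota 0 23).
  by vm_compute.
move=> x0; have /(allP chk) : (x : nat) \in iota 0 23 by rewrite mem_iota ltn_ord.
rewrite natr_Zp (negPf x0) orFb => /hasP[n]; rewrite mem_iota => nlt /eqP ->.
by exists n.
Qed.

(** After division by [s ^+ n] the equation reads [(- 2) ^+ n = - (d / c)], solvable because -2
    generates the units. *)
Lemma two_term_vanishes_F23 (c d r s : 'F_23) :
  c != 0 -> d != 0 -> s != 0 -> r = - 2 * s ->
  exists2 n : nat, (n < 22)%N & c * r ^+ n + d * s ^+ n = 0.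
Proof.
move=> c0 d0 s0 ->.
have [|n n22 en] := @opp2_generates_F23 (- (d / c)).
  by rewrite oppr_eq0 mulf_neq0 ?invr_eq0.
exists n => //; rewrite exprMn -en mulrA mulrN mulrCA divff // mulr1.
by rewrite mulNr addNr.
Qed.

(** * Complete Padovan sequences *)

(** Avoiding 0 rules out two-term expansions; avoiding 1 gives the base of a geometric sequence its
    full order. *)
Lemma complete_neq01 (p : nat) (a : int -> 'F_p) (n : nat) : prime p ->
  complete_Padovan_sequence a -> (0 < n < p.-1)%N -> (a n != 0) && (a n != 1).
Proof.
move=> pp [_ _ aS] /andP[n0 nN].
have : a n \in [set a (i : nat)%:Z | i : 'I_p.-1 & (0 < i)%N].
  by apply/imsetP; exists (Ordinal nN); rewrite ?inE.
rewrite aS => /imsetP[k]; rewrite inE => k1 ->.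
rewrite -!(inj_eq val_inj) /= !val_Fp_nat // !modn_small ?ltn_ord //.
  by rewrite (gtn_eqF k1) (gtn_eqF (ltnW k1)).
Qed.

Lemma complete_Padovan_geometric (p : nat) (a : int -> 'F_p) :
  prime p -> (5 <= p)%N ->
  (#|[set x : 'F_p | root ('X^3 - 'X - 1 : {poly 'F_p}) x]| < 3)%N ->
  complete_Padovan_sequence a ->
  exists b : 'F_p, [/\ b != 0, b ^+ 3 = b + 1 & forall n : int, a n = b ^ n].
Proof.
move=> pp p5 few aC; have [[a0 a3] aN _] := aC.
have cardF : #|'F_p|.-1 = p.-1 by rewrite card_Fp.
have N0 : (0 < p.-1)%N by rewrite -cardF card_pred_gt0.
have xN (x : 'F_p) : x != 0 -> x ^+ p.-1 = 1.
  by move=> x0; rewrite -cardF expf_card_pred.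
have rootE (x : 'F_p) :
    (x \in [set x : 'F_p | root ('X^3 - 'X - 1 : {poly 'F_p}) x])
      = (x ^+ 3 == x + 1).
  by rewrite inE rootE !hornerE -addrA -opprD subr_eq0.
have two_roots (r s t : 'F_p) : r ^+ 3 = r + 1 -> s ^+ 3 = s + 1 ->
    t ^+ 3 = t + 1 -> r != s -> (t == r) || (t == s).
  move=> rP sP tP rs; apply: contraLR few; rewrite -leqNgt negb_or => /andP[tr ts].
  apply: (@leq_trans #|[set t; r; s]|).
    by rewrite -setUA cardsU1 cards2 !inE rs negb_or tr ts.
  apply/subset_leq_card/subsetP => x; rewrite rootE !inE.
  by case/orP => [/orP[]|] /eqP ->; apply/eqP.
(* The normalised coefficient; the division is legitimate since p does not divide p - 1. *)
pose c x := fourier p.-1 a x / p.-1%:R.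
have N1 : p.-1%:R != 0 :> 'F_p.
  rewrite -(dvdn_pcharf (pchar_Fp pp)) gtnNdvd //.
  by rewrite prednK // prime_gt0.
have aE (n : nat) : (n < p.-1)%N -> a n = \sum_(x | x != 0) c x * x ^+ n.
  move=> nN; apply: (mulfI N1); rewrite -[in LHS]cardF -fourier_inversion ?cardF //.
  rewrite mulr_sumr; apply: eq_bigr => x _.
  by rewrite /c mulrA mulrCA divff // mulr1.
have cP (x : 'F_p) : x != 0 -> c x != 0 -> x ^+ 3 = x + 1.
  move=> x0; rewrite mulf_eq0 negb_or => /andP[cx _].
  exact: fourier_Padovan (xN x x0) aN a3 cx.
have [r /andP[r0 cr]] : exists r, (r != 0) && (c r != 0).
  apply/existsP; apply: contraT; rewrite negb_exists => /forallP nc.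
  move: a0; rewrite aE // big1 => [/esym/eqP|x x0]; first by rewrite oner_eq0.
  by move: (nc x); rewrite x0 /= negbK => /eqP ->; rewrite mul0r.
have rP := cP r r0 cr.
case: (boolP [exists s, [&& s != 0, s != r & c s != 0]]) => [|no_s].
  case/existsP => s /and3P[s0 sr cs]; exfalso.
  have sP := cP s s0 cs.
  have aE2 (n : nat) : (n < p.-1)%N -> a n = c r * r ^+ n + c s * s ^+ n.
    move=> nN; rewrite aE // (bigD1 r) //= (bigD1 s) /= ?s0 //.
    rewrite [X in _ + (_ + X)]big1 ?addr0 // => x /andP[/andP[x0 xr] xs].
    case: (eqVneq (c x) 0) => [->|cx]; first by rewrite mul0r.
    have := two_roots s r x sP rP (cP x x0 cx) sr.
    by rewrite (negPf xr) (negPf xs).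
  (* The third root -r-s equals [r] or [s]; exchanging [r] and [s] reduces the first case to the
     second. *)
  wlog rs : r s r0 s0 cr cs rP sP sr aE2 / r = - 2 * s.
    have tP := third_Padovan_root sP rP sr.
    move=> W; case/orP: (two_roots _ _ _ sP rP tP sr) => /eqP te.
      apply: (W r s) => //.
      have -> : r = - s - (- s - r) by ring.
      by rewrite te; ring.
    apply: (W s r) => //; rewrite 1?eq_sym //.
      by move=> n nN; rewrite addrC aE2.
    have -> : s = - r - (- s - r) by ring.
    by rewrite te; ring.
  rewrite rs in rP; have p23 := double_Padovan_root pp p5 sP rP.
  (* The index [n] of the zero is not 0, as [a 0 = 1], so it lies in the range where completeness
     forbids zeros. *)
  subst p; have [n n22 an0] := two_term_vanishes_F23 cr cs s0 rs.
  have := aE2 n n22; rewrite an0; case: n n22 {an0} => [|n] n22 an0.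
    by move/eqP: a0; rewrite an0 eq_sym oner_eq0.
  have /andP[] := complete_neq01 pp aC (n22 : (0 < n.+1 < 22)%N).
  by rewrite an0 eqxx.
exists r; split=> //; apply: (periodic_eq N0) => // n.
  by rewrite expfzDr // -exprnP xN // mulr1.
have aE1 m : (m < p.-1)%N -> a m%:Z = c r * r ^+ m.
  move=> mN; rewrite aE // (bigD1 r) //= big1 ?addr0 // => x /andP[x0 xr].
  move: no_s; rewrite negb_exists => /forallP /(_ x).
  by rewrite x0 xr /= negbK => /eqP ->; rewrite mul0r.
(* Evaluation at index 0 shows that the single coefficient is 1. *)
have := aE1 0%N N0; rewrite a0 expr0 mulr1 => c1 nN.
by rewrite aE1 // -c1 mul1r.
Qed.

Theorem theorem1p2 (p : nat) (p_prime : prime p) (p_ge5 : (5 <= p)%N)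
    (few_roots :
      (#|[set x : 'F_p | root ('X^3 - 'X - 1 : {poly 'F_p}) x]| < 3)%N)
    (a : int -> 'F_p) (a_Phi3 : Phi_sequence 3 a) :
  complete_Padovan_sequence a <->
  exists b : 'F_p, Padovan_primitive_root b /\ forall n : int, a n = b ^ n.
Proof.
have N0 : (0 < p.-1)%N by rewrite -subn1 subn_gt0 prime_gt1.
have xN (x : 'F_p) : x != 0 -> x ^+ p.-1 = 1.
  by move=> x0; rewrite -[in p.-1](card_Fp p_prime) expf_card_pred.
split=> [aC|[b [[b_prim b3] ab]]].
  have [b [b0 b3 ab]] :=
    complete_Padovan_geometric p_prime p_ge5 few_roots aC.
  exists b; split=> //; split=> //.
  (* A smaller positive exponent with [b]-power 1 would make [a] take the value 1 at an index
     strictly between 0 and p - 1. *)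
  rewrite /primitive_root_of_unity N0; apply/forallP => i.
  rewrite unity_rootE; case: (eqVneq i.+1 p.-1) => [->|iN].
    by rewrite xN // eqxx.
  have iltN : (0 < i.+1 < p.-1)%N by rewrite /= ltn_neqAle iN ltn_ord.
  have /andP[_] := complete_neq01 p_prime aC iltN.
  by rewrite ab -exprnP => /negPf ->.
have b0 : b != 0.
  apply: contra_eq_neq (prim_expr_order b_prim) => ->.
  by rewrite expr0n gtn_eqF // eq_sym oner_eq0.
split=> // [n|].
  by rewrite !ab expfzDr // -exprnP xN // mulr1.
(* In one direction, a power of [b] with exponent in 1, ..., p - 2 is neither 0 nor 1, so its
   representative exceeds 1. In the other, a nonzero residue is a power of [b], and exponent 0 would
   give residue 1. *)
apply/setP => x; apply/imsetP/imsetP => -[].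
  move=> i; rewrite inE => i0 ->; rewrite ab -exprnP.
  have lt_val : (val (b ^+ i) < p)%N.
    by rewrite -[X in (_ < X)%N](card_Fp p_prime) card_ord ltn_ord.
  exists (Ordinal lt_val); last by rewrite /= natr_Zp.
  rewrite inE /=.
  have := expf_neq0 i b0; have : b ^+ i != 1.
    rewrite -[1](expr0 b) (eq_prim_root_expr b_prim) modn_small // mod0n.
    by rewrite -lt0n.
  by rewrite -!(inj_eq val_inj) /=; case: (nat_of_ord _) => [|[]].
move=> k; rewrite inE => k1 ->.
have k0 : k%:R != 0 :> 'F_p.
  by rewrite -(dvdn_pcharf (pchar_Fp p_prime)) gtnNdvd // ltnW.
have [i ki] := prim_rootP b_prim (xN _ k0).
exists i; last by rewrite ab.
rewrite inE lt0n; apply: contraTneq k1 => i0.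
move/eqP: ki; rewrite i0 expr0 -(inj_eq val_inj) /= val_Fp_nat //.
by rewrite modn_small // => /eqP ->.
Qed.
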